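(* Let $\mathbb{H}_{\mathbb{Z}_5}(-1,-1)$ be the quaternion algebra over $\mathbb{Z}_5=\mathbb{Z}/5\mathbb{Z}$, and for $n\ge 0$ let $F_n=f_n+f_{n+1}i+f_{n+2}j+f_{n+3}k$ be the $n$-th Fibonacci quaternion, regarded as an element of $\mathbb{H}_{\mathbb{Z}_5}(-1,-1)$. Then: (i) for every $n\ge 0$, $F_n$ is a zero divisor in $\mathbb{H}_{\mathbb{Z}_5}(-1,-1)$ if and only if $n\equiv 1 \pmod 5$; (ii) among the distinct elements of $\{F_n : n\ge 0\}\subset \mathbb{H}_{\mathbb{Z}_5}(-1,-1)$, exactly $4$ are zero divisors and exactly $16$ are invertible.
   Context: $(f_n)_{n\ge 0}$ is the Fibonacci sequence: $f_0=0$, $f_1=1$, $f_n=f_{n-1}+f_{n-2}$ for $n\ge 2$. For a prime $p$, $\mathbb{Z}_p=\mathbb{Z}/p\mathbb{Z}$ and $\mathbb{H}_{\mathbb{Z}_p}(-1,-1)$ is the 4-dimensional associative unital $\mathbb{Z}_p$-algebra with basis $\{1,i,j,k\}$ and relations $i^2=j^2=-1$, $k=ij=-ji$. Integer coefficients are reduced modulo $p$. An element $x$ of a ring is a zero divisor if there is a nonzero $y$ with $xy=0$ or $yx=0$ (so $0$ counts as a zero divisor). *)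

(* Defs.v *)
From HB Require Import structures.
From mathcomp Require Import all_boot all_order all_algebra.
From mathcomp Require Import ring.
From mathcomp Require Import classical_sets functions cardinality.

Set Implicit Arguments.
Unset Strict Implicit.
Unset Printing Implicit Defensive.

Import GRing.Theory.
Local Open Scope ring_scope.

Fixpoint fib (n : nat) : nat :=
  if n is m.+1 then if m is l.+1 then (fib m + fib l)%N else 1%N else 0%N.

(* [Quat x0 x1 x2 x3] stands for x0 + x1 i + x2 j + x3 k in the quaternion
   algebra H_R(a, b), where i^2 = a, j^2 = b and k = ij = -ji.  The
   parameters [a] and [b] do not occur in the fields: they only select the
   multiplication. *)
Record quat (R : comNzRingType) (a b : R) : Type :=
  Quat { q0 : R; q1 : R; q2 : R; q3 : R }.

Arguments Quat {R a b}.

Section Quaternion.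
Variables (R : comNzRingType) (a b : R).
Local Notation H := (quat a b).

Definition quat_tuple (x : H) : R * R * R * R := (q0 x, q1 x, q2 x, q3 x).
Definition tuple_quat (t : R * R * R * R) : H :=
  Quat t.1.1.1 t.1.1.2 t.1.2 t.2.

Lemma quat_tupleK : cancel quat_tuple tuple_quat.
Proof. by case. Qed.

HB.instance Definition _ := Choice.copy H (can_type quat_tupleK).

Definition addq (x y : H) : H :=
  Quat (q0 x + q0 y) (q1 x + q1 y) (q2 x + q2 y) (q3 x + q3 y).
Definition oppq (x : H) : H := Quat (- q0 x) (- q1 x) (- q2 x) (- q3 x).

(* Bilinear extension of the table forced by i^2 = a, j^2 = b, k = ij = -ji:
   k^2 = -ab, ik = -ki = a j, kj = -jk = b i. *)
Definition mulq (x y : H) : H := Quat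
  (q0 x * q0 y + a * (q1 x * q1 y) + b * (q2 x * q2 y)
     - a * b * (q3 x * q3 y))
  (q0 x * q1 y + q1 x * q0 y + b * (q3 x * q2 y - q2 x * q3 y))
  (q0 x * q2 y + q2 x * q0 y + a * (q1 x * q3 y - q3 x * q1 y))
  (q0 x * q3 y + q3 x * q0 y + (q1 x * q2 y - q2 x * q1 y)).

Definition scaleq (c : R) (x : H) : H :=
  Quat (c * q0 x) (c * q1 x) (c * q2 x) (c * q3 x).

Fact addqA : associative addq.
Proof. by move=> x y z; rewrite /addq /= !addrA. Qed.
Fact addqC : commutative addq.
Proof. by move=> x y; congr Quat; rewrite addrC. Qed.
Fact add0q : left_id (Quat 0 0 0 0) addq.
Proof. by case=> *; rewrite /addq /= !add0r. Qed.
Fact addNq : left_inverse (Quat 0 0 0 0) oppq addq.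
Proof. by move=> x; rewrite /addq /= !addNr. Qed.

HB.instance Definition _ := GRing.isZmodule.Build H addqA addqC add0q addNq.

Fact mulqA : associative mulq.
Proof. by move=> x y z; congr Quat; rewrite /=; ring. Qed.
Fact mul1q : left_id (Quat 1 0 0 0) mulq.
Proof. by case=> *; congr Quat; rewrite /=; ring. Qed.
Fact mulq1 : right_id (Quat 1 0 0 0) mulq.
Proof. by case=> *; congr Quat; rewrite /=; ring. Qed.
Fact mulqDl : left_distributive mulq addq.
Proof. by move=> x y z; congr Quat; rewrite /=; ring. Qed.
Fact mulqDr : right_distributive mulq addq.
Proof. by move=> x y z; congr Quat; rewrite /=; ring. Qed.
Fact oneq_neq0 : (Quat 1 0 0 0 : H) != 0.
Proof. by apply/eqP => -[] /eqP; rewrite oner_eq0. Qed.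

HB.instance Definition _ := GRing.Zmodule_isNzRing.Build H
  mulqA mul1q mulq1 mulqDl mulqDr oneq_neq0.

Fact scaleqA (c d : R) (x : H) : scaleq c (scaleq d x) = scaleq (c * d) x.
Proof. by congr Quat; rewrite /= mulrA. Qed.
Fact scale1q : left_id 1 scaleq.
Proof. by case=> *; rewrite /scaleq /= !mul1r. Qed.
Fact scaleqDr : right_distributive scaleq +%R.
Proof. by move=> c x y; congr Quat; rewrite /= mulrDr. Qed.
Fact scaleqDl (x : H) : {morph scaleq^~ x : c d / c + d}.
Proof. by move=> c d; congr Quat; rewrite /= mulrDl. Qed.

HB.instance Definition _ := GRing.Zmodule_isLmodule.Build R H
  scaleqA scale1q scaleqDr scaleqDl.

Fact scaleqAl (c : R) (x y : H) : c *: (x * y) = (c *: x) * y.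
Proof. by congr Quat; rewrite /=; ring. Qed.
HB.instance Definition _ := GRing.Lmodule_isLalgebra.Build R H scaleqAl.

Fact scaleqAr (c : R) (x y : H) : c *: (x * y) = x * (c *: y).
Proof. by congr Quat; rewrite /=; ring. Qed.
HB.instance Definition _ := GRing.Lalgebra_isAlgebra.Build R H scaleqAr.

Definition qi : H := Quat 0 1 0 0.
Definition qj : H := Quat 0 0 1 0.
Definition qk : H := Quat 0 0 0 1.

Lemma qiE : qi * qi = a%:A.
Proof. by congr Quat; rewrite /=; ring. Qed.
Lemma qjE : qj * qj = b%:A.
Proof. by congr Quat; rewrite /=; ring. Qed.
Lemma qijE : qi * qj = qk.
Proof. by congr Quat; rewrite /=; ring. Qed.
Lemma qjiE : qj * qi = - qk.
Proof. by congr Quat; rewrite /=; ring. Qed.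

Lemma quatE (x : H) :
  x = q0 x *: 1 + q1 x *: qi + q2 x *: qj + q3 x *: qk.
Proof. by case: x => *; congr Quat; rewrite /=; ring. Qed.

Definition fibq (n : nat) : H :=
  (fib n)%:R *: 1 + (fib n.+1)%:R *: qi + (fib n.+2)%:R *: qj
    + (fib n.+3)%:R *: qk.

End Quaternion.

(* Zero itself is a zero divisor under this convention. *)
Definition zero_divisor (A : nzRingType) (x : A) : Prop :=
  exists y : A, y != 0 /\ (x * y = 0 \/ y * x = 0).

Definition invertible (A : nzRingType) (x : A) : Prop :=
  exists y : A, x * y = 1 /\ y * x = 1.

Definition F5_fibq (n : nat) : quat (-1 : 'F_5) (-1) := fibq (-1) (-1) n.

(* Main.v *)
Require Import Defs.
From mathcomp Require Import all_boot all_order all_algebra.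
From mathcomp Require Import ring zify.
From mathcomp Require Import classical_sets functions cardinality.

(** Over a field, a quaternion [x] satisfies [x * conjq x = conjq x * x = N(x)]
    with [N] the quadratic norm form, so [x] is invertible when [N(x) <> 0] and
    a zero divisor when [N(x) = 0] ([zero_divisorP], [invertibleP]).  For the
    Fibonacci quaternions the norm is itself a Fibonacci number up to a factor:
    [f_n^2 + f_(n+1)^2 = f_(2n+1)] gives

      [N(F_n) = f_(2n+1) + f_(2n+5) = 3 f_(2n+3)]   ([normq_fibq]).

    Since [f_(m+5) = 5 f_(m+1) + 3 f_m], the prime 5 divides [f_m] exactly when
    it divides [m]; as [5 | 2n + 3] means [n = 1 (mod 5)], this is part (i).

    For the count, the Fibonacci sequence modulo 5 has period 20 and a pair of
    consecutive residues determines the position inside the period, so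
    [F_m = F_n] exactly when [m = n (mod 20)] ([F5_fibq_eq]).  The distinct
    values of [F] are therefore indexed by the residues modulo 20, of which 4
    are 1 modulo 5 and 16 are not ([card_range_periodic]). *)

Set Implicit Arguments.
Unset Strict Implicit.
Unset Printing Implicit Defensive.

Import GRing.Theory.

(** * The norm form and zero divisors *)

Section Norm.
Local Open Scope ring_scope.

Lemma invertible_not_zero_divisor (A : nzRingType) (x : A) :
  invertible x -> ~ zero_divisor x.
Proof.
move=> [z [xz zx]] [y [/eqP y0 [xy|yx]]]; apply: y0.
  by rewrite -[y]mul1r -zx -mulrA xy mulr0.
by rewrite -[y]mulr1 -xz mulrA yx mul0r.
Qed.

Variables (R : comNzRingType) (a b : R).
Implicit Types x y : quat a b.

Definition conjq x : quat a b := Quat (q0 x) (- q1 x) (- q2 x) (- q3 x).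

Definition normq x : R :=
  q0 x ^+ 2 - a * q1 x ^+ 2 - b * q2 x ^+ 2 + a * b * q3 x ^+ 2.

Lemma mulq_conj x : x * conjq x = (normq x)%:A.
Proof. by rewrite /normq; congr Quat; rewrite /=; ring. Qed.

Lemma conj_mulq x : conjq x * x = (normq x)%:A.
Proof. by rewrite /normq; congr Quat; rewrite /=; ring. Qed.

Lemma conjqK : involutive conjq.
Proof. by case=> *; congr Quat; rewrite /= opprK. Qed.

Lemma conjq_eq0 x : (conjq x == 0) = (x == 0).
Proof.
have conj0 : conjq 0 = 0 by congr Quat; rewrite /= oppr0.
by rewrite -[X in _ == X]conj0 (inj_eq (can_inj conjqK)).
Qed.

End Norm.

Section NormField.
Local Open Scope ring_scope.
Variables (K : fieldType) (a b : K).
Implicit Types x : quat a b.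

(** When the norm vanishes, the conjugate is the annihilator, except for [0],
    whose conjugate is [0]. *)
Lemma zero_divisorP x : zero_divisor x <-> normq x = 0.
Proof.
split=> [[y [y0 xy]]|Nx0].
  suff /eqP : normq x *: y = 0.
    by rewrite scaler_eq0 (negPf y0) orbF => /eqP.
  case: xy => xy.
    by rewrite -mulr_algl -conj_mulq -mulrA xy mulr0.
  by rewrite -mulr_algr -mulq_conj mulrA xy mul0r.
have [->|x0] := eqVneq x 0.
  by exists 1; rewrite oner_neq0 mul0r; split; last left.
by exists (conjq x); rewrite conjq_eq0 mulq_conj Nx0 scale0r; split; last left.
Qed.

Lemma invertibleP x : invertible x <-> normq x <> 0.
Proof.
split=> [/invertible_not_zero_divisor nzx /zero_divisorP //|/eqP Nx].
exists ((normq x)^-1 *: conjq x).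
by rewrite -scalerAr -scalerAl mulq_conj conj_mulq scalerA mulVf // scale1r.
Qed.

End NormField.

(** * Fibonacci numbers *)

Lemma fibSS n : fib n.+2 = fib n.+1 + fib n.
Proof. by []. Qed.

Lemma fibD m n : fib (m + n).+1 = fib m.+1 * fib n.+1 + fib m * fib n.
Proof.
elim: m n => [|m IHm] n; first by rewrite add0n /= mul1n mul0n addn0.
by rewrite addSnnS IHm !fibSS; ring.
Qed.

Lemma fib_double n : fib n.*2.+1 = fib n ^ 2 + fib n.+1 ^ 2.
Proof. by rewrite -addnn fibD addnC. Qed.

(** Modulo 5 the recurrence [f_(k+5) = 5 f_(k+1) + 3 f_k] multiplies by a unit,
    which reduces the claim to [m < 5]. *)
Lemma dvd5_fib m : (5 %| fib m) = (5 %| m).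
Proof.
elim/ltn_ind: m => m IHm; have [|] := ltnP m 5.
  by case: m {IHm} => [|[|[|[|[|]]]]].
move=> m5; rewrite -(subnK m5); set k := m - 5.
rewrite dvdn_addl // -(IHm k); last by rewrite /k; lia.
have -> : fib (k + 5) = 5 * fib k.+1 + 3 * fib k.
  by rewrite addnC !fibSS; ring.
by rewrite dvdn_addr; [rewrite Gauss_dvdr | exact: dvdn_mulr].
Qed.

Lemma fib_mod5_period n k : fib (n + k * 20) = fib n %[mod 5].
Proof.
elim: k => [|k IHk]; first by rewrite addn0.
rewrite -IHk mulSnr addnA; set m := n + k * 20.
(* The coefficients are f_20 = 5 * 1353 and f_19 = 5 * 836 + 1. *)
have -> : fib (m + 20) = (1353 * fib m.+1 + 836 * fib m) * 5 + fib m.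
  have f20 : fib 20 = 5 * 1353 by vm_compute.
  have f19 : fib 19 = 5 * 836 + 1 by vm_compute.
  by rewrite addnS fibD f20 f19; ring.
by rewrite modnMDl.
Qed.

(** * Fibonacci quaternions *)

Section Fibq.
Local Open Scope ring_scope.

Lemma fibqE (R : comNzRingType) (a b : R) n :
  fibq a b n =
  Quat (fib n)%:R (fib n.+1)%:R (fib n.+2)%:R (fib n.+3)%:R.
Proof. by rewrite [RHS]quatE. Qed.

(** The sum [f_(2n+1) + f_(2n+5)] collapses to [3 f_(2n+3)] because [f_(m-2)]
    and [f_(m+2)] are [f_m - f_(m-1)] and [2 f_m + f_(m-1)]. *)
Lemma normq_fibq (R : comNzRingType) n :
  normq (fibq (-1 : R) (-1) n) = (3 * fib (n.*2 + 3))%:R.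
Proof.
have -> : (3 * fib (n.*2 + 3) = fib n.*2.+1 + fib n.+2.*2.+1)%N.
  by rewrite addnC !doubleS !fibSS; ring.
rewrite !fib_double fibqE /normq /= !natrD !natrX; ring.
Qed.

Lemma natr_F5_eq m n : (m%:R = n%:R :> 'F_5) <-> m = n %[mod 5].
Proof.
split=> [/(congr1 val)|mn]; first by rewrite /= !val_Fp_nat.
by apply: val_inj; rewrite /= !val_Fp_nat.
Qed.

End Fibq.

Lemma normq_F5_eq0 n : normq (F5_fibq n) = 0%R <-> n = 1 %[mod 5].
Proof.
rewrite normq_fibq -[0%R]/(0%:R)%R natr_F5_eq mod0n.
have -> : ((3 * fib (n.*2 + 3)) %% 5 = 0) <-> 5 %| n.*2 + 3.
  by rewrite -dvd5_fib -(@Gauss_dvdr 5 3) //; split=> /eqP.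
by lia.
Qed.

(** The pairs [(f_n, f_(n+1))] modulo 5 are distinct over one period, so the
    first two coordinates already locate [n] modulo 20. *)
Lemma F5_fibq_eq m n : F5_fibq m = F5_fibq n <-> m = n %[mod 20].
Proof.
have red k l : fib (k + l) = fib (k + l %% 20) %[mod 5].
  by rewrite {1}(divn_eq l 20) [_ * _ + _]addnC addnA fib_mod5_period.
rewrite /F5_fibq !fibqE; split=> [[]|mn]; last first.
  congr Quat; apply/natr_F5_eq.
  - by rewrite (red 0 m) (red 0 n) mn.
  - by rewrite (red 1 m) (red 1 n) mn.
  - by rewrite (red 2 m) (red 2 n) mn.
  - by rewrite (red 3 m) (red 3 n) mn.
move=> /natr_F5_eq mn0 /natr_F5_eq mn1 _ _.
move: mn0 mn1; rewrite (red 0 m) (red 0 n) (red 1 m) (red 1 n).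
pose window k := (fib k %% 5, fib k.+1 %% 5).
have window_inj : uniq [seq window k | k <- iota 0 20] by vm_compute.
have /uniqP window_nth := window_inj.
have nthE k : k < 20 -> nth (0, 0) [seq window k | k <- iota 0 20] k = window k.
  by move=> k20; rewrite (nth_map 0) ?size_iota // nth_iota.
have lt20 k : k %% 20 < 20 by rewrite ltn_mod.
move=> mn0 mn1; apply: (window_nth (0, 0)); rewrite ?inE ?size_map ?size_iota //.
by rewrite !nthE // /window -[fib (m %% 20)]/(fib (0 + m %% 20)) mn0 mn1.
Qed.

(** * Counting values of a periodic sequence *)

Section Counting.
Local Open Scope classical_set_scope.
Local Open Scope card_scope.

(** The values are indexed by the residues modulo [d], through the list of
    those that satisfy [p]. *)
Lemma card_range_periodic (T : Type) (f : nat -> T) (d : nat) (P : set T)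
    (p : pred nat) :
    (0 < d)%N ->
    (forall m n, f m = f n <-> m = n %[mod d]) ->
    (forall n, P (f n) <-> p n) ->
  range f `&` P #= `I_(count p (iota 0 d)).
Proof.
move=> d0 feq Pp; rewrite -size_filter; set s := filter p (iota 0 d).
have sP k : (k \in s) = p k && (k < d)%N by rewrite mem_filter mem_iota.
pose g i := f (nth 0 s i).
suff -> : range f `&` P = g @` `I_(size s).
  apply: inj_card_eq => i j; rewrite !inE /= => si sj /feq.
  have /andP[_ id] : p (nth 0 s i) && (nth 0 s i < d)%N by rewrite -sP mem_nth.
  have /andP[_ jd] : p (nth 0 s j) && (nth 0 s j < d)%N by rewrite -sP mem_nth.
  rewrite !modn_small // => /eqP.
  by rewrite nth_uniq // ?filter_uniq ?iota_uniq // => /eqP.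
apply/seteqP; split=> [_ [[n _ <-] Pn]|_ [i /= si <-]].
  have fn : f (n %% d)%N = f n by apply/feq; rewrite modn_mod.
  have ns : (n %% d)%N \in s by rewrite sP ltn_mod d0 andbT; apply/Pp; rewrite fn.
  by exists (index (n %% d)%N s); rewrite /= ?index_mem // /g nth_index.
split; first by exists (nth 0 s i).
by apply/Pp; have := mem_nth 0 si; rewrite sP => /andP[].
Qed.

End Counting.

(** * The count for Fibonacci quaternions *)

Local Open Scope classical_set_scope.
Local Open Scope card_scope.

Theorem proposition2p3 :
  (forall n : nat, zero_divisor (F5_fibq n) <-> n = 1 %[mod 5]) /\
  (range F5_fibq `&` [set x | zero_divisor x] #= `I_4) /\
  (range F5_fibq `&` [set x | invertible x] #= `I_16).
Proof.
have zdE n : zero_divisor (F5_fibq n) <-> n = 1 %[mod 5].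
  by rewrite zero_divisorP normq_F5_eq0.
split=> //; split.
  apply: (card_range_periodic (p := fun n => n == 1 %[mod 5]) _ F5_fibq_eq) => //.
  by move=> n /=; rewrite zdE; split=> /eqP.
apply: (card_range_periodic (p := fun n => n != 1 %[mod 5]) _ F5_fibq_eq) => //.
by move=> n /=; rewrite invertibleP normq_F5_eq0; split=> /eqP.
Qed.
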